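(* Let $T>0$ and let $\mathbf{V}^n=(V^{1,n},V^{2,n})$, $n=0,1,2,\dots$ with $t^n=n\Delta t\le T$, be a solution of the fully-discrete scheme with zero boundary data ($\mathbf{g}=0$), $$\frac{1}{\Delta t}\left(\mathbf{V}^{n+1}-\mathbf{V}^n\right)+u^{1,n+1}\circ\mathfrak{d}_x\mathbf{V}^{n+1}+u^{2,n+1}\circ\mathfrak{d}_y\mathbf{V}^{n+1}-C^{n+1}\mathbf{V}^{n+1}=\mathcal{B}\,\mathbf{V}^{n+1},$$ with $\mathbf{V}^0$ given. Suppose that the entries of the diagonal penalty matrices in $\mathcal{B}$ are chosen such that, for all $i=0,\dots,N-1$ and $j=0,\dots,M-1$, $$(\sigma_{\mathcal{R}})_{N-1,j}\le\frac{u^{1,-}(1,y_j)}{2},\qquad (\sigma_{\mathcal{L}})_{0,j}\le-\frac{u^{1,+}(0,y_j)}{2},$$ $$(\sigma_{\mathcal{U}})_{i,M-1}\le\frac{u^{2,-}(x_i,1)}{2},\qquad (\sigma_{\mathcal{D}})_{i,0}\le-\frac{u^{2,+}(x_i,0)}{2},$$ where $u^{\ell,+}=\max(u^\ell,0)$, $u^{\ell,-}=\min(u^\ell,0)$ for $\ell=1,2$, and where $u^\ell$ is evaluated at the time level $t^{n+1}$ at which $\mathcal{B}$ is applied. Then there is a constant $c$, depending on $u^1$, $u^2$ and their derivative approximations, but not on $N$ or $M$, such that, if $K$ is a constant chosen so that $(1-c\Delta t)^{-1}\le 1+K\Delta t$ for all sufficiently small $\Delta t$, then for all sufficiently small $\Delta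 t$ and all $n$ with $t^n\le T$, $$\|\mathbf{V}^n\|_{\mathbf{P}}^2\le e^{KT}\,\|\mathbf{V}^0\|_{\mathbf{P}}^2 .$$
   Context: **Equation.** The scheme discretizes, on $\Omega=[0,1]^2$, the two-dimensional magnetic induction equation $\mathbf{B}_t+u^1\mathbf{B}_x+u^2\mathbf{B}_y-C\mathbf{B}=0$, $C=\begin{pmatrix}-\partial_yu^2&\partial_yu^1\\ \partial_xu^2&-\partial_xu^1\end{pmatrix}$, where $\mathbf{B}=(B^1,B^2)^T$ is unknown and $\mathbf{u}=(u^1,u^2)^T$ is a given smooth velocity field on $\Omega\times[0,T]$ (possibly depending on time). **One-dimensional SBP operators.** Let $x_i=i\Delta x$, $i=0,\dots,N-1$, with $(N-1)\Delta x=1$. A summation-by-parts (SBP) operator approximating $\partial_x$ is an $N\times N$ matrix $D_x=P_x^{-1}Q_x$, where $P_x$ is a diagonal matrix with positive diagonal, the norm $\|w\|_{P_x}=(w^TP_xw)^{1/2}$ is equivalent (uniformly in $N$) to $(\Delta x\sum_kw_k^2)^{1/2}$, and $Q_x+Q_x^T=R_N-L_N$ with the $N\times N$ matrices $R_N=\mathrm{diag}(0,\dots,0,1)$, $L_N=\mathrm{diag}(1,0,\dots,0)$. Similarly $D_y=P_y^{-1}Q_y$ is an $M\times M$ SBP operator on the points $y_j=j\Delta y$, $j=0,\dots,M-1$, $(M-1)\Delta y=1$, with $Q_y+Q_y^T=R_M-L_M$. The SBP operators used have the following known property (commutator estimate): there is a constant $C_0$, independent of the number of grid points, such that for every smooth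 function $a$ on $[0,1]$ (identified with its grid function) and every grid function $w$, $\|D_x(a\circ w)-a\circ D_xw\|_{P_x}\le C_0\|\partial_xa\|_{L^\infty([0,1])}\|w\|_{P_x}$, and likewise for $D_y$. Here $\circ$ is the pointwise product, $(a\circ w)_j=a_jw_j$. As the operators are approximations of the derivatives, the grid functions obtained by applying the difference operators to the smooth functions $u^1,u^2$ are bounded uniformly in $N$ and $M$. **Two-dimensional notation.** A scalar grid function $w_{ij}=w(x_i,y_j)$ is ordered as the column vector $(w_{0,0},w_{0,1},\dots,w_{0,M-1},w_{1,0},\dots,w_{N-1,M-1})^T\in\mathbb{R}^{NM}$. With $\otimes$ the Kronecker product and $I_n$ the $n\times n$ identity, set $\mathfrak{d}_x=D_x\otimes I_M$, $\mathfrak{d}_y=I_N\otimes D_y$, $\mathbf{P}=P_x\otimes P_y$, $\mathcal{R}=R_N\otimes I_M$, $\mathcal{L}=L_N\otimes I_M$, $\mathcal{U}=I_N\otimes R_M$, $\mathcal{D}=I_N\otimes L_M$. For scalar grid functions $(w,v)_{\mathbf{P}}=w^T\mathbf{P}v$; for vector-valued grid functions $\mathbf{V}=(V^1,V^2)$, $\mathbf{W}=(W^1,W^2)$, $(\mathbf{V},\mathbf{W})_{\mathbf{P}}=(V^1,W^1)_{\mathbf{P}}+(V^2,W^2)_{\mathbf{P}}$ and $\|\mathbf{V}\|_{\mathbf{P}}=(\mathbf{V},\mathbf{V})_{\mathbf{P}}^{1/2}$. Scalar operators, and the pointwise product with a scalar grid function, act on vector-valued grid functions componentwise. **Scheme.**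 $\Delta t>0$ is the time step, $t^n=n\Delta t$, and $u^{\ell,n}$ is the grid function $u^\ell(x_i,y_j,t^n)$. The matrix $C^n=\begin{pmatrix}-\mathfrak{d}_yu^{2,n}&\mathfrak{d}_yu^{1,n}\\ \mathfrak{d}_xu^{2,n}&-\mathfrak{d}_xu^{1,n}\end{pmatrix}$ acts on $\mathbf{V}$ pointwise at each grid point (its entries are grid functions multiplied by $\circ$). The boundary penalty operator, acting componentwise, is $$\mathcal{B}=(P_x^{-1}\otimes I_M)(\Sigma_{\mathcal{L}}\mathcal{L}+\Sigma_{\mathcal{R}}\mathcal{R})+(I_N\otimes P_y^{-1})(\Sigma_{\mathcal{D}}\mathcal{D}+\Sigma_{\mathcal{U}}\mathcal{U}),$$ where $\Sigma_{\mathcal{L}},\Sigma_{\mathcal{R}},\Sigma_{\mathcal{D}},\Sigma_{\mathcal{U}}$ are diagonal $NM\times NM$ matrices whose diagonal entries $(\sigma_{\mathcal{L}})_{i,j}$, $(\sigma_{\mathcal{R}})_{i,j}$, $(\sigma_{\mathcal{D}})_{i,j}$, $(\sigma_{\mathcal{U}})_{i,j}$ are indexed by grid points in the same ordering as grid functions. For general boundary data $\mathbf{g}$ the right-hand side of the scheme is $\mathcal{B}(\mathbf{V}^{n+1}-\mathbf{g}^{n+1})$. *)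

(* Defs.v *)
From mathcomp Require Import all_boot all_order all_algebra.
From mathcomp Require Import all_classical all_reals all_analysis.
From mathcomp Require Import mxtens.

Set Implicit Arguments.
Unset Strict Implicit.
Unset Printing Implicit Defensive.

Import Order.TTheory GRing.Theory Num.Theory.
Import numFieldNormedType.Exports.

Local Open Scope classical_set_scope.
Local Open Scope ring_scope.

(* C^infty functions on a finite-dimensional V: all iterated directional
   derivatives exist and are continuous. *)
Fixpoint iter_derive (R : realType) (V : normedModType R) (f : V -> R)
    (vs : seq V) : V -> R :=
  if vs is v :: vs' then fun x => 'D_v (iter_derive f vs') x else f.

Definition smooth (R : realType) (V : normedModType R) (f : V -> R) : Prop :=
  forall vs : seq V,
    continuous (iter_derive f vs) /\
    forall x v, derivable (iter_derive f vs) x v.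

(* Smoothness on a non-open set is existence of a smooth extension; the values
   of f outside A are irrelevant. *)
Definition smooth_on (R : realType) (V : normedModType R) (A : set V)
    (f : V -> R) : Prop :=
  exists2 g : V -> R, smooth g & forall x, A x -> f x = g x.

(* A velocity component is a function of the triple (x, y, t). *)
Definition space_time (R : realType) (T : R) : set (R * R * R) :=
  (`[0, 1] `*` `[0, 1]) `*` `[0, T].

(* Meaningful for N > 1. *)
Definition node (R : realType) (N : nat) (i : 'I_N) : R := i%:R / N.-1%:R.

Definition Lmx (R : realType) (N : nat) : 'M[R]_N :=
  diag_mx (\row_i (i == 0 :> nat)%:R).
Definition Rmx (R : realType) (N : nat) : 'M[R]_N :=
  diag_mx (\row_i (i == N.-1 :> nat)%:R).

Definition inner (R : realType) (m : nat) (P : 'M[R]_m) (w v : 'cV[R]_m) : R :=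
  (w^T *m P *m v) 0 0.
Definition Pnorm (R : realType) (m : nat) (P : 'M[R]_m) (w : 'cV[R]_m) : R :=
  Num.sqrt (inner P w w).

Definition had (R : realType) (m : nat) (a w : 'cV[R]_m) : 'cV[R]_m :=
  \col_k (a k 0 * w k 0).

(* A family of SBP operators, one for each admissible number of points. The
   admissible numbers need not be all N > 1, as high-order boundary closures
   require a minimal number of points. *)
Record sbp_family (R : realType) := SbpFamily {
  sbp_size : set nat;
  sbp_P : forall N : nat, 'M[R]_N;
  sbp_Q : forall N : nat, 'M[R]_N;
  sbp_size_gt1 : forall N, sbp_size N -> (1 < N)%N;
  sbp_P_diag : forall N, sbp_size N -> is_diag_mx (sbp_P N);
  sbp_P_gt0 : forall N, sbp_size N -> forall i, 0 < sbp_P N i i;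
  sbp_PE : exists a b : R, [/\ 0 < a, 0 < b &
    forall N, sbp_size N -> forall w : 'cV[R]_N,
      let l2 := Num.sqrt (N.-1%:R^-1 * \sum_k w k 0 ^+ 2) in
      a * l2 <= Pnorm (sbp_P N) w <= b * l2];
  sbp_QE : forall N, sbp_size N -> sbp_Q N + (sbp_Q N)^T = Rmx R N - Lmx R N
}.

Definition sbp_D (R : realType) (S : sbp_family R) (N : nat) : 'M[R]_N :=
  invmx (sbp_P S N) *m sbp_Q S N.

Definition grid1 (R : realType) (N : nat) (a : R -> R) : 'cV[R]_N :=
  \col_i a (node R i).

(* Extending the function by 0 outside [0, 1] makes its L^oo norm over R the one
   over [0, 1]. *)
Definition Linfty01 (R : realType) (f : R -> R) : \bar R :=
  ('N[@lebesgue_measure R]_(+oo) [EFin \o patch (cst 0%R) `[0%R, 1%R]%classic f])%E.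

Definition commutator_estimate (R : realType) (S : sbp_family R) : Prop :=
  exists C0 : R, forall N, sbp_size S N ->
    forall a : R -> R, @smooth_on R R `[0, 1] a ->
    forall w : 'cV[R]_N,
      ((Pnorm (sbp_P S N) (sbp_D S N *m had (grid1 N a) w
                           - had (grid1 N a) (sbp_D S N *m w)))%:E
       <= C0%:E * Linfty01 a^`()%classic * (Pnorm (sbp_P S N) w)%:E)%E.

(* tensmx orders grid points as (i, j) |-> i * M + j. *)
Definition gidx (N M : nat) (i : 'I_N) (j : 'I_M) : 'I_(N * M) :=
  mxtens_index (i, j).

Definition grid2 (R : realType) (N M : nat) (u : R * R * R -> R) (t : R) :
    'cV[R]_(N * M) :=
  \col_k let ij := mxtens_unindex k in u (node R ij.1, node R ij.2, t).

Definition dx (R : realType) (SX : sbp_family R) (N M : nat) :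
    'M[R]_(N * M) := sbp_D SX N *t 1%:M.
Definition dy (R : realType) (SY : sbp_family R) (N M : nat) :
    'M[R]_(N * M) := 1%:M *t sbp_D SY M.
Definition P2 (R : realType) (SX SY : sbp_family R) (N M : nat) :
    'M[R]_(N * M) := sbp_P SX N *t sbp_P SY M.

Definition diff_bounded (R : realType) (SX SY : sbp_family R) (T : R)
    (u : R * R * R -> R) : Prop :=
  exists U : R, forall N M, sbp_size SX N -> sbp_size SY M ->
    forall t, 0 <= t <= T -> forall k,
      `|(dx SX N M *m grid2 N M u t) k 0| <= U /\
      `|(dy SY N M *m grid2 N M u t) k 0| <= U.

Notation vgrid R N M := ('cV[R]_(N * M) * 'cV[R]_(N * M))%type.

Definition vapp (R : realType) (N M : nat) (A : 'M[R]_(N * M))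
    (V : vgrid R N M) : vgrid R N M := (A *m V.1, A *m V.2).
Definition vhad (R : realType) (N M : nat) (a : 'cV[R]_(N * M))
    (V : vgrid R N M) : vgrid R N M := (had a V.1, had a V.2).
Definition vinner (R : realType) (N M : nat) (P : 'M[R]_(N * M))
    (V W : vgrid R N M) : R := inner P V.1 W.1 + inner P V.2 W.2.
Definition vnorm (R : realType) (N M : nat) (P : 'M[R]_(N * M))
    (V : vgrid R N M) : R := Num.sqrt (vinner P V V).

Definition Cop (R : realType) (SX SY : sbp_family R) (N M : nat)
    (u1 u2 : R * R * R -> R) (t : R) (V : vgrid R N M) : vgrid R N M :=
  (had (- (dy SY N M *m grid2 N M u2 t)) V.1
     + had (dy SY N M *m grid2 N M u1 t) V.2,
   had (dx SX N M *m grid2 N M u2 t) V.1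
     + had (- (dx SX N M *m grid2 N M u1 t)) V.2).

(* Each penalty matrix is given by its diagonal, a grid function. *)
Record penalty (R : realType) (N M : nat) := Penalty {
  penL : 'cV[R]_(N * M);
  penR : 'cV[R]_(N * M);
  penD : 'cV[R]_(N * M);
  penU : 'cV[R]_(N * M)
}.

Definition Bop (R : realType) (SX SY : sbp_family R) (N M : nat)
    (s : penalty R N M) : 'M[R]_(N * M) :=
  (invmx (sbp_P SX N) *t 1%:M)
    *m (diag_mx (penL s)^T *m (Lmx R N *t 1%:M)
        + diag_mx (penR s)^T *m (Rmx R N *t 1%:M))
  + (1%:M *t invmx (sbp_P SY M))
    *m (diag_mx (penD s)^T *m (1%:M *t Lmx R M)
        + diag_mx (penU s)^T *m (1%:M *t Rmx R M)).

Definition penalty_ok (R : realType) (N M : nat) (u1 u2 : R * R * R -> R)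
    (t : R) (s : penalty R N M) : Prop :=
  (forall (i : 'I_N) (j : 'I_M), i = N.-1 :> nat ->
     penR s (gidx i j) 0 <= Num.min (u1 (1, node R j, t)) 0 / 2) /\
  (forall (i : 'I_N) (j : 'I_M), i = 0 :> nat ->
     penL s (gidx i j) 0 <= - (Num.max (u1 (0, node R j, t)) 0 / 2)) /\
  (forall (i : 'I_N) (j : 'I_M), j = M.-1 :> nat ->
     penU s (gidx i j) 0 <= Num.min (u2 (node R i, 1, t)) 0 / 2) /\
  (forall (i : 'I_N) (j : 'I_M), j = 0 :> nat ->
     penD s (gidx i j) 0 <= - (Num.max (u2 (node R i, 0, t)) 0 / 2)).

Definition scheme_step (R : realType) (SX SY : sbp_family R) (N M : nat)
    (u1 u2 : R * R * R -> R) (dt t : R) (s : penalty R N M)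
    (V V' : vgrid R N M) : Prop :=
  dt^-1 *: (V' - V)
  + vhad (grid2 N M u1 t) (vapp (dx SX N M) V')
  + vhad (grid2 N M u2 t) (vapp (dy SY N M) V')
  - Cop SX SY u1 u2 t V'
  = vapp (Bop SX SY s) V'.

(* Main.v *)
(** Energy method. On each grid line, summation by parts together with the
    commutator estimate turns [2 (w, u w_x)_P] into the boundary terms
    [u w^2] at the two ends plus an error of size [|u_x| |w|^2]; the penalties
    absorb the boundary terms with the bad sign. Summing over the lines, with
    the entries of [C] bounded, the discrete energy satisfies
    [2 (V', V' - V)_P <= c dt |V'|^2], and [2 (V', V' - V)_P >= |V'|^2 - |V|^2]
    gives [(1 - c dt) |V'|^2 <= |V|^2]. A discrete Gronwall argument concludes;
    choosing [c > 0] forces [K >= 0], so that [exp (K t^n) <= exp (K T)]. *)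

Require Import Defs.
From mathcomp Require Import all_boot all_order all_algebra.
From mathcomp Require Import all_classical all_reals all_analysis.
From mathcomp Require Import mxtens ring lra.

Import Order.TTheory GRing.Theory Num.Theory.
Import numFieldNormedType.Exports.

Local Open Scope classical_set_scope.
Local Open Scope ring_scope.

(** * Inner products weighted by a positive diagonal matrix *)

Section Inner.
Context {R : realType} {m : nat}.
Implicit Types (P : 'M[R]_m) (w v a : 'cV[R]_m).

Lemma innerDr P w v1 v2 : inner P w (v1 + v2) = inner P w v1 + inner P w v2.
Proof. by rewrite /inner mulmxDr mxE. Qed.

Lemma innerNr P w v : inner P w (- v) = - inner P w v.
Proof. by rewrite /inner mulmxN mxE. Qed.

Lemma innerBr P w v1 v2 : inner P w (v1 - v2) = inner P w v1 - inner P w v2.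
Proof. by rewrite innerDr innerNr. Qed.

Lemma innerZr P w b v : inner P w (b *: v) = b * inner P w v.
Proof. by rewrite /inner -scalemxAr mxE. Qed.

Lemma inner_diag P w v : is_diag_mx P ->
  inner P w v = \sum_k P k k * (w k 0 * v k 0).
Proof.
move=> /is_diag_mxP diagP; rewrite /inner -mulmxA mxE.
apply: eq_bigr => k _; rewrite !mxE (bigD1 k)//= big1 ?addr0; first by ring.
by move=> j jk; rewrite diagP ?mul0r// eq_sym.
Qed.

Lemma inner_had P a w v : is_diag_mx P ->
  inner P w (had a v) = inner P (had a w) v.
Proof.
by move=> dP; rewrite !inner_diag//; apply: eq_bigr => k _; rewrite !mxE; ring.
Qed.

Lemma inner_ge0 P w : is_diag_mx P -> (forall i, 0 < P i i) -> 0 <= inner P w w.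
Proof.
move=> dP P0; rewrite inner_diag// sumr_ge0// => k _.
by apply: mulr_ge0; [exact: ltW|exact: sqr_ge0].
Qed.

Lemma sqr_Pnorm P w : is_diag_mx P -> (forall i, 0 < P i i) ->
  Pnorm P w ^+ 2 = inner P w w.
Proof. by move=> dP P0; rewrite sqr_sqrtr// inner_ge0. Qed.

(** Expanding [0 <= |k w - v|^2] gives [2 k (w, v) <= k^2 |w|^2 + |v|^2 <= 2 k^2 |w|^2], and
    dividing by [2 k] concludes. It turns the commutator estimate, a bound on norms, into a bound on
    an inner product. *)
Lemma inner_le_Pnorm P k w v : is_diag_mx P -> (forall i, 0 < P i i) ->
  0 < k -> Pnorm P v <= k * Pnorm P w -> inner P w v <= k * inner P w w.
Proof.
move=> dP P0 k0 vw.
have vv : inner P v v <= k ^+ 2 * inner P w w.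
  rewrite -!sqr_Pnorm// -exprMn ler_pXn2r// nnegrE ?sqrtr_ge0//.
  by rewrite mulr_ge0 ?sqrtr_ge0// ltW.
have : 0 <= inner P (k *: w - v) (k *: w - v) by exact: inner_ge0.
have -> : inner P (k *: w - v) (k *: w - v) =
    k ^+ 2 * inner P w w - 2 * k * inner P w v + inner P v v.
  rewrite !inner_diag// !mulr_sumr -sumrB -big_split/=.
  by apply: eq_bigr => i _; rewrite !mxE; ring.
move=> sq; rewrite -(ler_pM2l k0); nra.
Qed.

Lemma diag_gt0_unitmx P : is_diag_mx P -> (forall i, 0 < P i i) -> P \in unitmx.
Proof.
move=> /is_diag_mxP dP P0.
have -> : P = diag_mx (\row_i P i i).
  apply/matrixP => i j; rewrite !mxE; have [->|ij] := eqVneq i j => //=.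
  exact: dP.
rewrite unitmxE det_diag unitfE prodf_seq_neq0; apply/allP => i _ /=.
by rewrite mxE gt_eqF.
Qed.

(** The norm matrix cancels the inverse in front of the penalty, so that penalty and boundary terms
    can be compared as unweighted sums. *)
Lemma inner_invmx P w v : P \in unitmx ->
  inner P w (invmx P *m v) = \sum_k w k 0 * v k 0.
Proof.
move=> uP; rewrite /inner mulmxA mulmxK// mxE.
by apply: eq_bigr => k _; rewrite mxE.
Qed.

Lemma dot_diag_mx w v (d : 'rV[R]_m) :
  (w^T *m diag_mx d *m v) 0 0 = \sum_k d 0 k * (w k 0 * v k 0).
Proof.
rewrite mul_mx_diag mxE; apply: eq_bigr => k _; rewrite !mxE; ring.
Qed.
End Inner.

(** * Energy estimate on one grid line *)

Lemma max0_ge (R : realType) (a : R) : a <= Num.max a 0.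
Proof. by rewrite le_max lexx. Qed.

Lemma min0_le (R : realType) (a : R) : Num.min a 0 <= a.
Proof. by rewrite ge_min lexx. Qed.

(* Summation by parts moves D from [w] to [a w], and the commutator bound moves
   it back; what remains are boundary terms [a_0 w_0^2 - a_{N-1} w_{N-1}^2],
   which the penalties dominate. *)
Lemma sbp_penalty_dissipation {R : realType} (S : sbp_family R) (N : nat)
    (a w l r : 'cV[R]_N) (k : R) : sbp_size S N -> 0 < k ->
  Pnorm (sbp_P S N) (sbp_D S N *m had a w - had a (sbp_D S N *m w))
    <= k * Pnorm (sbp_P S N) w ->
  (forall i : 'I_N, i = 0%N :> nat -> l i 0 <= - (Num.max (a i 0) 0 / 2)) ->
  (forall i : 'I_N, i = N.-1 :> nat -> r i 0 <= Num.min (a i 0) 0 / 2) ->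
  2 * (inner (sbp_P S N) w
         (invmx (sbp_P S N) *m (had l (Lmx R N *m w) + had r (Rmx R N *m w)))
       - inner (sbp_P S N) w (had a (sbp_D S N *m w)))
    <= k * inner (sbp_P S N) w w.
Proof.
move=> SN k0 comm hl hr.
have dP := sbp_P_diag SN; have P0 := sbp_P_gt0 SN.
have uP := diag_gt0_unitmx _ dP P0.
(* It suffices to bound the left-hand side by the inner product of [w] with the commutator. *)
apply: le_trans (inner_le_Pnorm _ _ _ _ dP P0 k0 comm).
have QE v1 v2 : inner (sbp_P S N) v1 (sbp_D S N *m v2)
    = (v1^T *m sbp_Q S N *m v2) 0 0.
  by rewrite /inner /sbp_D -!mulmxA (mulmxA (sbp_P S N)) mulmxV// mul1mx.
have parts : inner (sbp_P S N) w (had a (sbp_D S N *m w))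
    + inner (sbp_P S N) w (sbp_D S N *m had a w)
  = (w^T *m (Rmx R N - Lmx R N) *m had a w) 0 0.
  rewrite inner_had// !QE -(sbp_QE SN) mulmxDr mulmxDl [RHS]mxE [LHS]addrC.
  congr (_ + _).
  (* A 1 by 1 matrix equals its transpose, which turns [(a w)^T Q w] into [w^T Q^T (a w)]. *)
  have tr00 (A : 'M[R]_1) : A 0 0 = A^T 0 0 by rewrite mxE.
  by rewrite tr00 !trmx_mul trmxK mulmxA.
have -> : inner (sbp_P S N) w (sbp_D S N *m had a w
      - had a (sbp_D S N *m w))
  = (w^T *m (Rmx R N - Lmx R N) *m had a w) 0 0
      - 2 * inner (sbp_P S N) w (had a (sbp_D S N *m w)).
  by rewrite -parts innerBr; ring.
(* The transport term [2 (w, a D w)] cancels on both sides; only sums supported on the two end nodes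
   remain. *)
rewrite mulrBr lerD2r inner_invmx// mulmxBr mulmxBl mxE [X in _ <= _ + X]mxE.
rewrite !dot_diag_mx mulr_sumr -sumrB; apply: ler_sum => i _.
rewrite !mul_diag_mx !mxE.
(* Compare node by node. The first node requires [2 l <= - a], which follows from [a <= max(a, 0)];
   the last requires [2 r <= a], which follows from [min(a, 0) <= a]; interior nodes contribute
   nothing. *)
have [/hl|_] := eqVneq (i : nat) 0%N; have [/hr|_] := eqVneq (i : nat) N.-1;
  have := max0_ge _ (a i 0); have := min0_le _ (a i 0);
  have : 0 <= w i 0 * w i 0 by [exact: sqr_ge0];
  move: (Num.max _ _) (Num.min _ _) => x y.
all: rewrite ?mul1r ?mul0r ?mulr0 ?addr0 ?add0r.
all: try nra.
Qed.

(** * Restriction of grid functions and Kronecker products to grid lines *)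

Section Lines.
Context {R : realType} {N M : nat}.
Implicit Types (A : 'M[R]_N) (B : 'M[R]_M) (w v s : 'cV[R]_(N * M)).

Definition xline w (j : 'I_M) : 'cV[R]_N := \col_i w (gidx i j) 0.
Definition yline w (i : 'I_N) : 'cV[R]_M := \col_j w (gidx i j) 0.

Lemma sum_gidx (F : 'I_(N * M) -> R) :
  \sum_k F k = \sum_i \sum_j F (gidx i j).
Proof.
rewrite pair_big/= (reindex (@mxtens_index N M))/=.
  by apply: eq_bigr => -[i j].
by exists (@mxtens_unindex N M) => k _; rewrite (mxtens_indexK, mxtens_unindexK).
Qed.

Lemma tens_diag A B : is_diag_mx A -> is_diag_mx B -> is_diag_mx (A *t B).
Proof.
move=> /is_diag_mxP dA /is_diag_mxP dB; apply/is_diag_mxP => k l.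
case: (mxtens_indexP k) => i j; case: (mxtens_indexP l) => i' j'.
rewrite tensmxE; have [->|ii'] := eqVneq i i'; last by rewrite dA ?mul0r.
have [->|jj'] := eqVneq j j'; last by rewrite dB ?mulr0.
by rewrite eqxx.
Qed.

Lemma tens_diag_gt0 A B : (forall i, 0 < A i i) -> (forall j, 0 < B j j) ->
  forall k, 0 < (A *t B) k k.
Proof.
move=> A0 B0 k; case: (mxtens_indexP k) => i j.
by rewrite tensmxE mulr_gt0.
Qed.

(** Since both factors are diagonal, the lines decouple: a one-dimensional estimate holding on every
    line with a common constant can be summed into one on the whole grid. *)
Lemma inner_tens_xline A B w v : is_diag_mx A -> is_diag_mx B ->
  inner (A *t B) w v = \sum_j B j j * inner A (xline w j) (xline v j).
Proof.
move=> dA dB; rewrite inner_diag ?tens_diag// sum_gidx exchange_big/=.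
apply: eq_bigr => j _; rewrite inner_diag// mulr_sumr.
by apply: eq_bigr => i _; rewrite tensmxE !mxE; ring.
Qed.

Lemma inner_tens_yline A B w v : is_diag_mx A -> is_diag_mx B ->
  inner (A *t B) w v = \sum_i A i i * inner B (yline w i) (yline v i).
Proof.
move=> dA dB; rewrite inner_diag ?tens_diag// sum_gidx.
apply: eq_bigr => i _; rewrite inner_diag// mulr_sumr.
by apply: eq_bigr => j _; rewrite tensmxE !mxE; ring.
Qed.

Lemma xline_mul A w j : xline ((A *t 1%:M) *m w) j = A *m xline w j.
Proof.
apply/colP => i; rewrite !mxE sum_gidx; apply: eq_bigr => i' _.
rewrite (bigD1 j)//= big1 => [|j' j'j]; rewrite tensmxE !mxE.
  by rewrite eqxx mulr1 addr0.
by rewrite eq_sym (negPf j'j) mulr0 mul0r.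
Qed.

Lemma yline_mul B w i : yline ((1%:M *t B) *m w) i = B *m yline w i.
Proof.
apply/colP => j; rewrite !mxE sum_gidx (bigD1 i)//= [X in _ + X]big1 ?addr0.
  by apply: eq_bigr => j' _; rewrite tensmxE !mxE eqxx mul1r.
move=> i' i'i; rewrite big1// => j' _.
by rewrite tensmxE !mxE eq_sym (negPf i'i) !mul0r.
Qed.

Lemma xlineD w v j : xline (w + v) j = xline w j + xline v j.
Proof. by apply/colP => i; rewrite !mxE. Qed.

Lemma ylineD w v i : yline (w + v) i = yline w i + yline v i.
Proof. by apply/colP => j; rewrite !mxE. Qed.

Lemma xline_had w v j : xline (had w v) j = had (xline w j) (xline v j).
Proof. by apply/colP => i; rewrite !mxE. Qed.

Lemma yline_had w v i : yline (had w v) i = had (yline w i) (yline v i).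
Proof. by apply/colP => j; rewrite !mxE. Qed.

Lemma diag_mx_had s w : diag_mx s^T *m w = had s w.
Proof. by rewrite mul_diag_mx; apply/colP => k; rewrite !mxE. Qed.

End Lines.

(** * Energy estimates on the two-dimensional grid *)

(** The penalty operator is split by direction, so that each half is paired with the transport term
    in the same direction. *)
Definition Bopx {R : realType} (SX : sbp_family R) {N M : nat}
    (s : penalty R N M) : 'M[R]_(N * M) :=
  (invmx (sbp_P SX N) *t 1%:M)
    *m (diag_mx (penL s)^T *m (Lmx R N *t 1%:M)
        + diag_mx (penR s)^T *m (Rmx R N *t 1%:M)).

Definition Bopy {R : realType} (SY : sbp_family R) {N M : nat}
    (s : penalty R N M) : 'M[R]_(N * M) :=
  (1%:M *t invmx (sbp_P SY M))
    *m (diag_mx (penD s)^T *m (1%:M *t Lmx R M)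
        + diag_mx (penU s)^T *m (1%:M *t Rmx R M)).

Section Dissipation2.
Context {R : realType} (SX SY : sbp_family R) {N M : nat}.
Hypotheses (SXN : sbp_size SX N) (SYM : sbp_size SY M).
Implicit Types (w a : 'cV[R]_(N * M)) (s : penalty R N M).

(** The weights of the lines, the diagonal entries of [sbp_P SY M], are positive, so
    [sbp_penalty_dissipation] on each line can be multiplied by them and summed over [j]. *)
Lemma x_dissipation s a w (k : R) : 0 < k ->
  (forall j, let P := sbp_P SX N in let D := sbp_D SX N in
     let aj := xline a j in let wj := xline w j in
     Pnorm P (D *m had aj wj - had aj (D *m wj)) <= k * Pnorm P wj) ->
  (forall (i : 'I_N) (j : 'I_M), i = 0%N :> nat ->
     penL s (gidx i j) 0 <= - (Num.max (a (gidx i j) 0) 0 / 2)) ->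
  (forall (i : 'I_N) (j : 'I_M), i = N.-1 :> nat ->
     penR s (gidx i j) 0 <= Num.min (a (gidx i j) 0) 0 / 2) ->
  2 * (inner (P2 SX SY N M) w (Bopx SX s *m w)
       - inner (P2 SX SY N M) w (had a (dx SX N M *m w)))
    <= k * inner (P2 SX SY N M) w w.
Proof.
move=> k0 comm hl hr; have dX := sbp_P_diag SXN; have dY := sbp_P_diag SYM.
rewrite !(inner_tens_xline _ _ _ _ dX dY) -sumrB !mulr_sumr.
apply: ler_sum => j _.
rewrite -mulrBr mulrCA [X in _ <= X]mulrCA ler_pM2l ?(sbp_P_gt0 SYM)//.
(* Every factor acts either along x or pointwise, so restriction to the line passes through all of
   them. *)
rewrite xline_had xline_mul -mulmxA xline_mul mulmxDl xlineD -!(mulmxA (diag_mx _)).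
rewrite !diag_mx_had !xline_had !xline_mul.
apply: (sbp_penalty_dissipation SX N (xline a j) (xline w j) _ _ k SXN k0
  (comm j)) => i i0.
  rewrite [xline _ _ _ _]mxE [xline _ _ _ _]mxE; exact: hl.
rewrite [xline _ _ _ _]mxE [xline _ _ _ _]mxE; exact: hr.
Qed.

Lemma y_dissipation s a w (k : R) : 0 < k ->
  (forall i, let P := sbp_P SY M in let D := sbp_D SY M in
     let ai := yline a i in let wi := yline w i in
     Pnorm P (D *m had ai wi - had ai (D *m wi)) <= k * Pnorm P wi) ->
  (forall (i : 'I_N) (j : 'I_M), j = 0%N :> nat ->
     penD s (gidx i j) 0 <= - (Num.max (a (gidx i j) 0) 0 / 2)) ->
  (forall (i : 'I_N) (j : 'I_M), j = M.-1 :> nat ->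
     penU s (gidx i j) 0 <= Num.min (a (gidx i j) 0) 0 / 2) ->
  2 * (inner (P2 SX SY N M) w (Bopy SY s *m w)
       - inner (P2 SX SY N M) w (had a (dy SY N M *m w)))
    <= k * inner (P2 SX SY N M) w w.
Proof.
move=> k0 comm hl hr; have dX := sbp_P_diag SXN; have dY := sbp_P_diag SYM.
rewrite !(inner_tens_yline _ _ _ _ dX dY) -sumrB !mulr_sumr.
apply: ler_sum => i _.
rewrite -mulrBr mulrCA [X in _ <= X]mulrCA ler_pM2l ?(sbp_P_gt0 SXN)//.
rewrite yline_had yline_mul -mulmxA yline_mul mulmxDl ylineD -!(mulmxA (diag_mx _)).
rewrite !diag_mx_had !yline_had !yline_mul.
apply: (sbp_penalty_dissipation SY M (yline a i) (yline w i) _ _ k SYM k0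
  (comm i)) => j j0.
  rewrite [yline _ _ _ _]mxE [yline _ _ _ _]mxE; exact: hl.
rewrite [yline _ _ _ _]mxE [yline _ _ _ _]mxE; exact: hr.
Qed.

(** At each grid point this bounds the quadratic form [- a x^2 + (b + c) x y - d y^2], whose
    coefficients are at most [U] in absolute value: the square terms cost [U (x^2 + y^2)] and the
    mixed term costs the same. *)
Lemma coupling_le (u1 u2 : R * R * R -> R) (t U : R) (V : vgrid R N M) :
  (forall k, `|(dx SX N M *m grid2 N M u1 t) k 0| <= U) ->
  (forall k, `|(dy SY N M *m grid2 N M u1 t) k 0| <= U) ->
  (forall k, `|(dx SX N M *m grid2 N M u2 t) k 0| <= U) ->
  (forall k, `|(dy SY N M *m grid2 N M u2 t) k 0| <= U) ->
  vinner (P2 SX SY N M) V (Cop SX SY u1 u2 t V)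
    <= 2 * U * vinner (P2 SX SY N M) V V.
Proof.
move=> hx1 hy1 hx2 hy2.
have dP : is_diag_mx (P2 SX SY N M) by apply: tens_diag; exact: sbp_P_diag.
have P0 : forall k, 0 < P2 SX SY N M k k by apply: tens_diag_gt0; exact: sbp_P_gt0.
rewrite /vinner /= !inner_diag// -!big_split/= mulr_sumr; apply: ler_sum => k _.
move: (hx1 k) (hy1 k) (hx2 k) (hy2 k); rewrite -!mulrDr mulrCA ler_pM2l//.
move: (dx SX N M *m grid2 N M u1 t) (dy SY N M *m grid2 N M u1 t)
  (dx SX N M *m grid2 N M u2 t) (dy SY N M *m grid2 N M u2 t) => d b c a.
rewrite !mxE; move: (a k 0) (b k 0) (c k 0) (d k 0) (V.1 k 0) (V.2 k 0).
move=> {}a {}b {}c {}d x y; rewrite !ler_norml.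
move=> /andP[d1 d2] /andP[b1 b2] /andP[c1 c2] /andP[a1 a2].
have x2 : 0 <= x * x by exact: sqr_ge0.
have y2 : 0 <= y * y by exact: sqr_ge0.
have p2 : 0 <= (x + y) * (x + y) by exact: sqr_ge0.
have m2 : 0 <= (x - y) * (x - y) by exact: sqr_ge0.
have xa : 0 <= (U + a) * (x * x) by rewrite mulr_ge0//; lra.
have yd : 0 <= (U + d) * (y * y) by rewrite mulr_ge0//; lra.
(* The mixed terms are handled through [4 x y = (x + y)^2 - (x - y)^2], which makes the final
   inequality linear in the products listed here. *)
have bp : 0 <= (U - b) * ((x + y) * (x + y)) by rewrite mulr_ge0//; lra.
have bm : 0 <= (U + b) * ((x - y) * (x - y)) by rewrite mulr_ge0//; lra.
have cp : 0 <= (U - c) * ((x + y) * (x + y)) by rewrite mulr_ge0//; lra.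
have cm : 0 <= (U + c) * ((x - y) * (x - y)) by rewrite mulr_ge0//; lra.
lra.
Qed.

Lemma BopE s : Bop SX SY s = Bopx SX s + Bopy SY s.
Proof. by []. Qed.

End Dissipation2.

(** * Smooth functions restricted to affine lines *)

Section Slices.
Context {R : realType} {V : normedModType R} (e q : V).

Let slice : R -> V := fun x => x *: e + q.

Lemma slice_shift (h v x : R) :
  slice (h *: v + x) = h *: (v *: e) + slice x.
Proof. by rewrite /slice addrA scalerDl scalerA. Qed.

(** By [slice_shift] the two difference quotients are the same function of [h], so the limits agree
    without any differentiability assumption. *)
Lemma derive_slice (f : V -> R) (x v : R) :
  'D_v (f \o slice) x = 'D_(v *: e) f (slice x).
Proof.
rewrite /derive [X in lim (X @ _)](_ : _ = fun h => h^-1 *: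
  ((f \o shift (slice x)) (h *: (v *: e)) - f (slice x)))//.
by apply/funext => h /=; rewrite slice_shift.
Qed.

Lemma derivable_slice (f : V -> R) (x v : R) :
  derivable f (slice x) (v *: e) -> derivable (f \o slice) x v.
Proof.
rewrite /derivable => df.
rewrite [X in cvg (X @ _)](_ : _ = fun h => h^-1 *:
  ((f \o shift (slice x)) (h *: (v *: e)) - f (slice x)))//.
by apply/funext => h /=; rewrite slice_shift.
Qed.

Lemma iter_derive_slice (f : V -> R) (vs : seq R) :
  iter_derive (f \o slice) vs = iter_derive f [seq v *: e | v <- vs] \o slice.
Proof.
elim: vs => [//|v vs IH]; apply/funext => x /=.
by rewrite IH derive_slice.
Qed.

Lemma continuous_slice : continuous slice.
Proof.
move=> x; apply: cvgD; last exact: cvg_cst.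
by apply: cvgZr_tmp; exact: cvg_id.
Qed.

(** Iterated derivatives of the restriction are iterated derivatives of [f] along multiples of [e].
    This makes the commutator estimate, stated for functions of one variable, applicable to a
    velocity component on a grid line. *)
Lemma smooth_slice (f : V -> R) : smooth f -> @smooth R R (f \o slice).
Proof.
move=> sf vs; rewrite iter_derive_slice; have [cf df] := sf [seq v *: e | v <- vs].
split=> [x|x v]; last exact: derivable_slice.
by apply: continuous_comp; [exact: continuous_slice|exact: cf].
Qed.
End Slices.

(** * Commutator constants uniform over grids, lines and times *)

Lemma smooth_derive_bounded {R : realType} {V : normedModType R} (g : V -> R)
    (e : V) (K : set V) : smooth g -> compact K ->
  exists2 m : R, 0 < m & forall x, K x -> `|'D_e g x| <= m.
Proof.
move=> sg cK; have [cg _] := sg [:: e].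
have /compact_bounded [b [_ bP]] : compact ('D_e g @` K).
  by apply: continuous_compact => //; exact: continuous_subspaceT.
(* The boundedness property yields every bound strictly above [b]; |b| + 1 is such a bound and is
   positive. *)
exists (`|b| + 1) => [|x Kx]; first by rewrite ltr_pwDr.
by apply: (bP (`|b| + 1)); [rewrite (le_lt_trans (ler_norm b))// ltrDl|exists x].
Qed.

(** A pointwise bound dominates the essential supremum; outside the unit interval the patched
    function is 0, which is where [0 <= m] enters. *)
Lemma Linfty01_le {R : realType} (f : R -> R) (m : R) : 0 <= m ->
  (forall x, x \in `[0, 1]%R -> `|f x| <= m) -> (Linfty01 f <= m%:E)%E.
Proof.
move=> m0 fm; rewrite /Linfty01 unlock.
case: ifP => _; last by rewrite lee_fin.
apply/ess_sup_inf.ess_supP; apply: nearW => x /=; rewrite lee_fin patchE.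
by case: ifPn => [|_]; [rewrite inE => /fm|rewrite normr0].
Qed.

(** The derivative of the slice is ['D_e g], bounded on the compact [K]; hence [k] can be fixed
    before the grid size and the base point [q] of the line. *)
Lemma commutator_slice {R : realType} {V : normedModType R} (S : sbp_family R)
    (g : V -> R) (e : V) (K : set V) :
  commutator_estimate S -> smooth g -> compact K ->
  exists2 k : R, 0 < k & forall N, sbp_size S N -> forall q : V,
    (forall x, x \in `[0, 1]%R -> K (x *: e + q)) -> forall w : 'cV[R]_N,
    let a := grid1 N (fun x => g (x *: e + q)) in
    Pnorm (sbp_P S N) (sbp_D S N *m had a w - had a (sbp_D S N *m w))
      <= k * Pnorm (sbp_P S N) w.
Proof.
move=> [C0 comm] sg cK; have [m m0 gm] := smooth_derive_bounded _ e _ sg cK.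
(* The sign of [C0] is unknown, so |C0| + 1 replaces it to make [k] positive. Enlarging [C0] is
   sound because the norm it multiplies is nonnegative. *)
exists ((`|C0| + 1) * m) => [|N SN q Kq w /=].
  by rewrite mulr_gt0// ltr_pwDr.
pose a := g \o (fun x : R => x *: e + q).
have sa : @smooth_on R R `[0, 1] a.
  by exists a => //; exact: smooth_slice.
have L0 : (0 <= Linfty01 a^`()%classic)%E.
  exact: Lnorm_ge0.
have Lm : (Linfty01 a^`()%classic <= m%:E)%E.
  apply: Linfty01_le => [|x /Kq Kx]; first exact: ltW.
  rewrite derive1E (derive_slice e q g x 1) scale1r; exact: gm.
rewrite -lee_fin; apply: (le_trans (comm N SN _ sa w)).
rewrite EFinM; apply: lee_wpmul2r; first by rewrite lee_fin sqrtr_ge0.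
rewrite EFinM.
apply: (@le_trans _ _ ((`|C0| + 1)%:E * Linfty01 a^`()%classic)%E).
  by apply: lee_wpmul2r => //; rewrite lee_fin (le_trans (ler_norm _))// lerDl.
by apply: lee_wpmul2l => //; rewrite lee_fin addr_ge0.
Qed.

Lemma node_itv {R : realType} (N : nat) (i : 'I_N) : (1 < N)%N ->
  node R i \in `[0, 1]%R.
Proof.
move=> N1; have N0 : 0 < N.-1%:R :> R by rewrite ltr0n -subn1 subn_gt0.
rewrite in_itv/= divr_ge0//= ler_pdivrMr// mul1r ler_nat.
by rewrite -ltnS prednK// ltnW.
Qed.

Lemma node_first {R : realType} (N : nat) (i : 'I_N) : i = 0%N :> nat ->
  node R i = 0.
Proof. by rewrite /node => ->; rewrite mul0r. Qed.

Lemma node_last {R : realType} (N : nat) (i : 'I_N) : (1 < N)%N ->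
  i = N.-1 :> nat -> node R i = 1.
Proof.
move=> N1; rewrite /node => ->.
by rewrite divff// pnatr_eq0 -lt0n -subn1 subn_gt0.
Qed.

Lemma grid2E {R : realType} (N M : nat) (u : R * R * R -> R) (t : R)
    (i : 'I_N) (j : 'I_M) :
  grid2 N M u t (gidx i j) 0 = u (node R i, node R j, t).
Proof. by rewrite mxE /gidx mxtens_indexK. Qed.

Lemma compact_space_time {R : realType} (T : R) : compact (space_time T).
Proof. by do 2?[apply: compact_setX]; exact: segment_compact. Qed.

(** The smooth extension [g] replaces [u], with which it agrees at every node. The lines lie in the
    compact [space_time T], so [k] depends neither on the line nor on the time. *)
Lemma xline_commutator {R : realType} (S : sbp_family R) (T : R)
    (u : R * R * R -> R) :
  commutator_estimate S -> smooth_on (space_time T) u ->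
  exists2 k : R, 0 < k & forall N M, sbp_size S N -> (1 < M)%N ->
    forall t, 0 <= t <= T -> forall (j : 'I_M) (w : 'cV[R]_N),
    Pnorm (sbp_P S N) (sbp_D S N *m had (xline (grid2 N M u t) j) w
                       - had (xline (grid2 N M u t) j) (sbp_D S N *m w))
      <= k * Pnorm (sbp_P S N) w.
Proof.
move=> comm [g sg ug].
have [k k0 hk] := commutator_slice _ g (1, 0, 0) _ comm sg (compact_space_time T).
exists k => // N M SN M1 t tT j w; pose q : R * R * R := (0, node R j, t).
have qE x : x *: (1, 0, 0) + q = (x, node R j, t).
  by congr (_, _, _); rewrite /= ?scaler0 ?add0r// addr0 -[RHS]mulr1.
have inK x : x \in `[0, 1]%R -> space_time T (x, node R j, t).
  by move=> x01; split=> //; split=> //; exact: node_itv.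
rewrite (_ : xline _ _ = grid1 N (fun x => g (x *: (1, 0, 0) + q))).
  by apply: hk => // x x01; rewrite qE; exact: inK.
apply/colP => i; rewrite mxE grid2E mxE qE ug//.
by apply/inK/node_itv/(sbp_size_gt1 SN).
Qed.

Lemma yline_commutator {R : realType} (S : sbp_family R) (T : R)
    (u : R * R * R -> R) :
  commutator_estimate S -> smooth_on (space_time T) u ->
  exists2 k : R, 0 < k & forall N M, (1 < N)%N -> sbp_size S M ->
    forall t, 0 <= t <= T -> forall (i : 'I_N) (w : 'cV[R]_M),
    Pnorm (sbp_P S M) (sbp_D S M *m had (yline (grid2 N M u t) i) w
                       - had (yline (grid2 N M u t) i) (sbp_D S M *m w))
      <= k * Pnorm (sbp_P S M) w.
Proof.
move=> comm [g sg ug].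
have [k k0 hk] := commutator_slice _ g (0, 1, 0) _ comm sg (compact_space_time T).
exists k => // N M N1 SM t tT i w; pose q : R * R * R := (node R i, 0, t).
have qE y : y *: (0, 1, 0) + q = (node R i, y, t).
  by congr (_, _, _); rewrite /= ?scaler0 ?add0r// addr0 -[RHS]mulr1.
have inK y : y \in `[0, 1]%R -> space_time T (node R i, y, t).
  by move=> y01; split=> //; split=> //; exact: node_itv.
rewrite (_ : yline _ _ = grid1 M (fun y => g (y *: (0, 1, 0) + q))).
  by apply: hk => // y y01; rewrite qE; exact: inK.
apply/colP => j; rewrite mxE grid2E mxE qE ug//.
by apply/inK/node_itv/(sbp_size_gt1 SM).
Qed.

(** * Energy inequality for one time step *)

Lemma vnorm_sqr {R : realType} (SX SY : sbp_family R) (N M : nat)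
    (V : vgrid R N M) : sbp_size SX N -> sbp_size SY M ->
  vnorm (P2 SX SY N M) V ^+ 2 = vinner (P2 SX SY N M) V V.
Proof.
move=> SN SM; rewrite sqr_sqrtr// addr_ge0// inner_ge0//.
all: by [apply: tens_diag; exact: sbp_P_diag
        |apply: tens_diag_gt0; exact: sbp_P_gt0].
Qed.

(** The difference of the two sides is [|w - v|^2], the numerical dissipation of the backward Euler
    step. *)
Lemma polarization_le {R : realType} (m : nat) (P : 'M[R]_m) (w v : 'cV[R]_m) :
  is_diag_mx P -> (forall i, 0 < P i i) ->
  inner P w w - inner P v v <= 2 * inner P w (w - v).
Proof.
move=> dP P0; have := inner_ge0 P (w - v) dP P0.
suff -> : inner P (w - v) (w - v) = 2 * inner P w (w - v)
  - (inner P w w - inner P v v) by rewrite subr_ge0.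
rewrite !inner_diag// -sumrB mulr_sumr -sumrB.
by apply: eq_bigr => i _; rewrite !mxE; ring.
Qed.

Section EnergyStep.
Context {R : realType} (SX SY : sbp_family R) (T : R) (u1 u2 : R * R * R -> R).
Hypotheses (u1_smooth : smooth_on (space_time T) u1)
  (u2_smooth : smooth_on (space_time T) u2)
  (commX : commutator_estimate SX) (commY : commutator_estimate SY)
  (u1_bounded : diff_bounded SX SY T u1) (u2_bounded : diff_bounded SX SY T u2).

Lemma energy_step : exists2 c : R, 0 < c &
  forall N M, sbp_size SX N -> sbp_size SY M ->
  forall (dt t : R) (s : penalty R N M) (V V' : vgrid R N M),
    0 < dt -> 0 <= t <= T -> penalty_ok u1 u2 t s ->
    scheme_step SX SY u1 u2 dt t s V V' ->
    (1 - c * dt) * vnorm (P2 SX SY N M) V' ^+ 2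
      <= vnorm (P2 SX SY N M) V ^+ 2.
Proof.
have [kx kx0 hx] := xline_commutator _ _ _ commX u1_smooth.
have [ky ky0 hy] := yline_commutator _ _ _ commY u2_smooth.
have [U1 hU1] := u1_bounded; have [U2 hU2] := u2_bounded.
(* Absolute values make [U] nonnegative and a common bound for all entries of [C], whatever the
   signs of [U1] and [U2]. *)
pose U := `|U1| + `|U2|.
have U1U : U1 <= U by rewrite (le_trans (ler_norm _))// lerDl.
have U2U : U2 <= U by rewrite (le_trans (ler_norm _))// lerDr.
(* [kx] and [ky] come from the commutators in the two directions, and [4 * U] is twice the constant
   of [coupling_le]; positivity comes from [kx] and [ky]. *)
exists (kx + ky + 4 * U) => [|N M SN SM dt t s V V' dt0 tT pen step].
  by rewrite ltr_pwDl ?addr_gt0// mulr_ge0// addr_ge0.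
have N1 := sbp_size_gt1 SN; have M1 := sbp_size_gt1 SM.
rewrite !vnorm_sqr//; set P := P2 SX SY N M.
have dP : is_diag_mx P by apply: tens_diag; exact: sbp_P_diag.
have P0 : forall k, 0 < P k k by apply: tens_diag_gt0; exact: sbp_P_gt0.
case: pen => [penR_le [penL_le [penU_le penD_le]]].
have dissX w := x_dissipation SX SY SN SM s (grid2 N M u1 t) w kx kx0
  (fun j => hx N M SN M1 t tT j (xline w j)).
have dissY w := y_dissipation SX SY SN SM s (grid2 N M u2 t) w ky ky0
  (fun i => hy N M N1 SM t tT i (yline w i)).
have {}dissX w : 2 * (inner P w (Bopx SX s *m w)
    - inner P w (had (grid2 N M u1 t) (dx SX N M *m w))) <= kx * inner P w w.
  (* At the end nodes the coordinate is exactly 0 or 1, so the grid values of the velocity are the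
     boundary values in [penalty_ok]. *)
  apply: dissX => i j ij; rewrite grid2E.
    by rewrite (node_first _ _ ij); exact: penL_le.
  by rewrite (node_last _ _ N1 ij); exact: penR_le.
have {}dissY w : 2 * (inner P w (Bopy SY s *m w)
    - inner P w (had (grid2 N M u2 t) (dy SY N M *m w))) <= ky * inner P w w.
  apply: dissY => i j ij; rewrite grid2E.
    by rewrite (node_first _ _ ij); exact: penD_le.
  by rewrite (node_last _ _ M1 ij); exact: penU_le.
have coupl : vinner P V' (Cop SX SY u1 u2 t V') <= 2 * U * vinner P V' V'.
  by apply: coupling_le => // k; [
    apply: le_trans U1U; have [] := hU1 N M SN SM t tT k|
    apply: le_trans U1U; have [] := hU1 N M SN SM t tT k|
    apply: le_trans U2U; have [] := hU2 N M SN SM t tT k|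
    apply: le_trans U2U; have [] := hU2 N M SN SM t tT k].
have eq1 := congr1 (fun W => inner P V'.1 W.1) step.
have eq2 := congr1 (fun W => inner P V'.2 W.2) step.
move: eq1 eq2; rewrite /= !BopE !mulmxDl !(innerDr, innerNr, innerZr).
have pol1 := polarization_le _ _ V'.1 V.1 dP P0.
have pol2 := polarization_le _ _ V'.2 V.2 dP P0.
move: pol1 pol2 coupl (dissX V'.1) (dissX V'.2) (dissY V'.1) (dissY V'.2).
rewrite /vinner !(innerDr, innerNr, innerZr).
set n1 := inner P V'.1 V'.1; set n2 := inner P V'.2 V'.2.
set p1 := inner P V'.1 V.1; set p2 := inner P V'.2 V.2.
set m1 := inner P V.1 V.1; set m2 := inner P V.2 V.2.
move=> pol1 pol2 coupl x1 x2 y1 y2 eq1 eq2.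
(* The scheme tested with [V'] expresses the time difference through transport, penalty and coupling
   terms, which the estimates above bound. *)
have rate : 2 * (dt^-1 * (n1 - p1) + dt^-1 * (n2 - p2))
    <= (kx + ky + 4 * U) * (n1 + n2) by lra.
move: rate; rewrite -mulrDr mulrCA ler_pdivrMl// => rate.
lra.
Qed.
End EnergyStep.

(** * Discrete Gronwall argument *)

Theorem theorem3p1 (R : realType) (T : R) (u1 u2 : R * R * R -> R)
    (SX SY : sbp_family R)
    (T_gt0 : 0 < T)
    (u1_smooth : smooth_on (space_time T) u1)
    (u2_smooth : smooth_on (space_time T) u2)
    (commX : commutator_estimate SX)
    (commY : commutator_estimate SY)
    (u1_bounded : diff_bounded SX SY T u1)
    (u2_bounded : diff_bounded SX SY T u2) :
  exists c : R, forall K : R,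
    (\forall dt \near (0 : R)^'+, (1 - c * dt)^-1 <= 1 + K * dt) ->
    \forall dt \near (0 : R)^'+,
      forall N M : nat, sbp_size SX N -> sbp_size SY M ->
      forall (s : nat -> penalty R N M) (V : nat -> vgrid R N M),
        (forall n : nat, n.+1%:R * dt <= T ->
           penalty_ok u1 u2 (n.+1%:R * dt) (s n.+1) /\
           scheme_step SX SY u1 u2 dt (n.+1%:R * dt) (s n.+1)
             (V n) (V n.+1)) ->
        forall n : nat, n%:R * dt <= T ->
          vnorm (P2 SX SY N M) (V n) ^+ 2
          <= expR (K * T) * vnorm (P2 SX SY N M) (V 0%N) ^+ 2.
Proof.
have [c c0 step] := energy_step SX SY T u1 u2 u1_smooth u2_smooth commX commY
  u1_bounded u2_bounded.
exists c => K nearK.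
have nearc : \forall dt \near (0 : R)^'+, dt < c^-1.
  by apply: nbhs_right_lt; rewrite invr_gt0.
near=> dt => N M SN SM s V scheme n nT.
have dt0 : 0 < dt by near: dt; exact: nbhs_right_gt.
have cdt : 0 < 1 - c * dt.
  by rewrite subr_gt0 mulrC -ltr_pdivlMr// mul1r; near: dt.
have KP : (1 - c * dt)^-1 <= 1 + K * dt by near: dt.
(* Since [c * dt] is nonnegative, [1 - c * dt] is at most 1 and its inverse at least 1; the choice
   of [K] then gives [0 <= K * dt]. *)
have Kdt1 : 1 <= 1 + K * dt.
  by apply: le_trans KP; rewrite invf_ge1// gerBl mulr_ge0// ltW.
have K0 : 0 <= K by rewrite -(pmulr_lge0 _ dt0); lra.
(* The induction keeps the exponent [n K dt], which grows by [K * dt] per step because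
   [(1 - c dt)^-1 <= 1 + K dt <= exp (K dt)]. It is replaced by [K T] only at the end. *)
have growth : vnorm (P2 SX SY N M) (V n) ^+ 2
    <= expR (n%:R * (K * dt)) * vnorm (P2 SX SY N M) (V 0%N) ^+ 2.
  elim: n nT => [_|n IH nT]; first by rewrite mul0r expR0 mul1r.
  have ndt : n%:R * dt <= T.
    by apply: le_trans nT; rewrite ler_wpM2r ?ler_nat// ltW.
  have [pen sch] := scheme n nT.
  have t0T : 0 <= n.+1%:R * dt <= T by rewrite nT mulr_ge0// ltW.
  have := step N M SN SM dt _ _ _ _ dt0 t0T pen sch.
  rewrite mulrC -ler_pdivlMr// => /le_trans; apply.
  rewrite mulrC -natr1 mulrDl mul1r expRD
    [expR _ * expR _]mulrC -mulrA.
  apply: ler_pM; [by rewrite invr_ge0 ltW|exact: sqr_ge0| |exact: IH].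
  by apply: (le_trans KP); exact: expR_ge1Dx.
apply: (le_trans growth); rewrite ler_wpM2r ?sqr_ge0// ler_expR.
by rewrite mulrCA ler_wpM2l.
Unshelve. all: by end_near.
Qed.
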